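(* Let $r\ge0$ be an integer and $l=r+1$ or $l=r+2$, and let the advection equation $w_t+w_x=0$ with periodic boundary conditions on $[0,1]$ be discretized in space by the optimally accurate first-derivative finite-difference operator $\mathcal{D}_x$ with stencil $(l,r)$. (1) If $l\ge2$ and the time-integrator is the forward Euler method (FE), then for any $\mu_c>0$ the fully-discretized method with $\delta t=\mu_ch$ is unstable in the limit $h\to0$, i.e. it is unstable for all sufficiently small $h=1/N$. (2) If $l\ge3$ and the time-integrator is either RK2 or LSRK3, then for any fixed $\mu_c>0$ the fully-discretized method with $\delta t=\mu_ch$ is unstable in the limit $h\to0$, i.e. it is unstable for all sufficiently small $h=1/N$.
   Context: On $N$ uniform cells of $[0,1]$, $h=1/N$, $\mathcal{D}_xw_j=\frac1h\sum_{k=-l}^r a_kw_{j+k}$ (indices modulo $N$). The optimally accurate operator is the one with coefficients $$a_k=-\frac{(-1)^k}{k}\frac{l!\,r!}{(l+k)!\,(r-k)!}\ (-l\le k\le r,\ k\neq0),\qquad a_0=-\sum_{-l\le k\le r,\,k\ne0}\frac1k.$$ With $\boldsymbol{S}$ the $N\times N$ cyclic shift matrix, $(\boldsymbol{S}\boldsymbol{W})_j=w_{j+1}$ (indices modulo $N$), put $\boldsymbol{A}=\sum_{k=-l}^r a_k\boldsymbol{S}^k$ and $\boldsymbol{M}=-\boldsymbol{A}$. The semi-discretized system is $\frac{d\boldsymbol{W}}{dt}=\frac1h\boldsymbol{M}\boldsymbol{W}$, and an explicit Runge-Kutta method with stability polynomial $p_s$ and step $\delta t$ gives $\boldsymbol{W}^{n+1}=p_s(\mu\boldsymbol{M})\boldsymbol{W}^n$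 with $\mu=\delta t/h$. Time-integrators: FE has $p_s(z)=1+z$. RK2 denotes any two-stage, second-order explicit Runge-Kutta method, with $p_s(z)=1+z+\frac12z^2$. LSRK3 is the four-stage, third-order explicit Runge-Kutta method with nodes $0,\frac12,1,1$, nonzero stage coefficients $\hat a_{21}=\frac12$, $\hat a_{32}=1$, $\hat a_{43}=1$, and weights $\frac16,\frac23,0,\frac16$, for which $p_s(z)=1+z+\frac12z^2+\frac16z^3+\frac1{12}z^4$. The fully-discretized method with given $h,\delta t$ is stable if the powers $[p_s(\mu\boldsymbol{M})]^n$, $n\ge0$, are bounded, and unstable otherwise (since $\boldsymbol{M}$ is diagonalizable, unstable means that $p_s(\mu\boldsymbol{M})$ has an eigenvalue of modulus greater than $1$). *)

(* Defs.v *)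
From HB Require Import structures.
From mathcomp Require Import all_boot all_order all_algebra.
From mathcomp Require Import all_classical all_reals all_analysis.
Set Implicit Arguments.
Unset Strict Implicit.
Unset Printing Implicit Defensive.
Import Order.TTheory GRing.Theory Num.Theory.
Import numFieldNormedType.Exports.
Local Open Scope classical_set_scope.
Local Open Scope ring_scope.

(** * Spatial discretization *)

(* [stencil l i] is the offset k = i - l, so that i < l + r + 1 enumerates
   -l <= k <= r. *)
Definition stencil (l i : nat) : int := i%:Z - l%:Z.

(* For -l <= k <= r the integers l + k and r - k are nonnegative, so the
   absolute value [absz] is only a cast from int to nat. *)
Definition fd_coef (R : realType) (l r : nat) (k : int) : R :=
  if k == 0 then
    - \sum_(i < (l + r).+1 | stencil l i != 0) (stencil l i)%:~R^-1
  else
    - ((-1) ^ k / k%:~R) *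
    ((l`!)%:R * (r`!)%:R / (((absz (l%:Z + k))`!)%:R * ((absz (r%:Z - k))`!)%:R)).

(* Throughout, the number of cells is N = n.+1. *)

(* (S W)_i = W_(i+1); [ordS] is the cyclic successor on 'I_N. *)
Definition shift_mx (R : realType) (n : nat) : 'M[R]_n.+1 :=
  \matrix_(i, j) (j == ordS i)%:R.

Definition fd_mx (R : realType) (l r n : nat) : 'M[R]_n.+1 :=
  \sum_(i < (l + r).+1)
     fd_coef R l r (stencil l i) *: shift_mx R n ^ stencil l i.

Definition semidiscrete_mx (R : realType) (l r n : nat) : 'M[R]_n.+1 :=
  - fd_mx R l r n.

(** * Explicit Runge-Kutta methods *)

Record butcher (R : realType) (s : nat) := Butcher {
  rk_coef : 'M[R]_s;
  rk_weight : 'I_s -> R;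
  rk_node : 'I_s -> R }.

Definition explicit_rk (R : realType) (s : nat) (m : butcher R s) : Prop :=
  forall i j : 'I_s, (i <= j)%N -> rk_coef m i j = 0.

Section Step.
Variables (R : realType) (V : lmodType R) (s : nat) (m : butcher R s).
Variables (f : R -> V -> V) (t dt : R) (y : V).

Definition rk_slopes (k : 'I_s -> V) : 'I_s -> V := fun i =>
  f (t + rk_node m i * dt) (y + dt *: \sum_(j < s) rk_coef m i j *: k j).

(* For an explicit method the i-th slope depends only on the slopes j < i,
   hence s iterations from any starting point compute the unique solution of
   the stage equations; see [rk_stagesP]. *)
Definition rk_stages : 'I_s -> V := iter s rk_slopes (fun=> 0).

Definition rk_step : V := y + dt *: \sum_(i < s) rk_weight m i *: rk_stages i.

Lemma rk_stagesP : explicit_rk m -> rk_slopes rk_stages = rk_stages.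
Proof.
move=> me; apply/funext => i; rewrite /rk_stages -iterS.
have H e : forall (i : 'I_s) (p q : nat), (i <= e)%N -> (i < p)%N ->
    (i < q)%N -> iter p rk_slopes (fun=> 0) i = iter q rk_slopes (fun=> 0) i.
  elim: e => [|e IH] {}i [|p] [|q] //.
    rewrite leqn0 => /eqP i0 _ _ /=; rewrite /rk_slopes.
    do 2 f_equal; f_equal; apply: eq_bigr => j _.
    by rewrite me ?i0 // !scale0r.
  move=> ie ip iq /=; rewrite /rk_slopes.
  do 2 f_equal; f_equal; apply: eq_bigr => j _.
  have [ij|ji] := leqP i j; first by rewrite me // !scale0r.
  congr (_ *: _); apply: IH.
  - by rewrite -ltnS; apply: leq_trans ie.
  - exact: leq_trans ji _.
  - exact: leq_trans ji _.
by apply: (H s); rewrite ?ltnS // ltnW // ltn_ord.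
Qed.

End Step.

(* One step of size 1 from the value 1 for the equation y' = z y, with z the
   polynomial indeterminate. *)
Definition stability_poly (R : realType) (s : nat) (m : butcher R s) :
    {poly R} :=
  rk_step m (fun _ q => 'X * q) 0 1 1.

(* Between finite-dimensional spaces, this is the class C^k. *)
Fixpoint class_C (R : realType) (U V : normedModType R) (k : nat)
    (f : U -> V) : Prop :=
  continuous f /\
  if k is k'.+1 then
    forall v : U, (forall x, derivable f x v) /\ class_C k' ('D_v f)
  else True.

Definition smooth (R : realType) (U V : normedModType R) (f : U -> V) : Prop :=
  forall k, class_C k f.

(* The local error is O(dt^(p+1)) on every smooth system y' = f(t, y); this is
   order at least p. A two-stage explicit method never has order 3, so
   for such methods order at least 2 is the same as order 2. *)
Definition rk_order (R : realType) (s : nat) (m : butcher R s) (p : nat) :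
    Prop :=
  forall (d : nat) (f : R -> 'rV[R]_d.+1 -> 'rV[R]_d.+1),
    smooth (fun x : R * 'rV[R]_d.+1 => f x.1 x.2) ->
  forall (y : R -> 'rV[R]_d.+1) (t0 : R),
    (\forall t \near t0, is_derive (t : R) (1 : R) y (f t (y t))) ->
  (fun dt : R => y (t0 + dt) - rk_step m f t0 dt (y t0))
    =O_ (0^'+) (fun dt : R => dt ^+ p.+1).

Definition FE (R : realType) : butcher R 1 :=
  Butcher 0 (fun=> 1) (fun=> 0).

Definition is_RK2 (R : realType) (m : butcher R 2) : Prop :=
  explicit_rk m /\ rk_order m 2.

Definition LSRK3 (R : realType) : butcher R 4 :=
  Butcher
    (\matrix_(i, j) nth 0 (nth [::] [:: [::];
                                        [:: 1 / 2];
                                        [:: 0; 1];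
                                        [:: 0; 0; 1]] i) j)
    (fun i => nth 0 [:: 1 / 6; 2 / 3; 0; 1 / 6] i)
    (fun i => nth 0 [:: 0; 1 / 2; 1; 1] i).

(** * Fully-discretized methods *)

Definition power_bounded (R : realType) (n : nat) (P : 'M[R]_n.+1) : Prop :=
  exists C : R, forall k : nat, `|P ^+ k| <= C.

Definition fully_discrete_mx (R : realType) (s : nat) (m : butcher R s)
    (l r n : nat) (h dt : R) : 'M[R]_n.+1 :=
  horner_mx ((dt / h) *: semidiscrete_mx R l r n) (stability_poly m).

Definition fd_unstable (R : realType) (s : nat) (m : butcher R s)
    (l r n : nat) (h dt : R) : Prop :=
  ~ power_bounded (fully_discrete_mx m l r n h dt).

(* Instability of the method with dt = mu_c h for all large N = n.+1, h = 1/N. *)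
Definition unstable_in_the_limit (R : realType) (s : nat) (m : butcher R s)
    (l r : nat) (mu_c : R) : Prop :=
  \forall n \near \oo,
    let h := n.+1%:R^-1 in fd_unstable m l r n h (mu_c * h).

(* Main.v *)
Require Import Defs.
From mathcomp Require Import all_boot all_order all_algebra.
From mathcomp Require Import all_classical all_reals all_analysis.
From mathcomp Require Import ring lra.
Import Order.TTheory GRing.Theory Num.Theory.
Import numFieldNormedType.Exports.
Set Implicit Arguments.
Unset Strict Implicit.
Unset Printing Implicit Defensive.
Local Open Scope classical_set_scope.
Local Open Scope ring_scope.

(** The Fourier mode of angle t = 2 pi / N is an eigenvector of mu M with
    eigenvalue z = a + i b = - mu sum_k a_k exp(i k t). The coefficients satisfy
    sum_k a_k k^m = 0 for m <= l + r, m <> 1, and sum_k a_k k = 1, so that b is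
    equivalent to - mu t while a = O(t^4) if l >= 2 and a = O(t^6) if l >= 3.
    On the imaginary axis |p_s(i b)|^2 - 1 is b^2 for FE, b^4/4 for RK2 and
    b^4/12 + O(b^6) for LSRK3; these gains dominate the O(a) perturbation for
    small t, whatever the sign of a. *)

(** * Moments of the coefficients: binomial identities *)

(** No complex matrices occur: the real and imaginary parts of the mode form a pair of real vectors
    on which the shift, hence every polynomial in it, acts by a complex scalar. The positive moments
    are finite differences, because k a_k is an alternating binomial weight. The zeroth moment is
    not, because of the 1/k in a_k; it rests on a harmonic identity that explains the prescribed
    a_0. A gain of size b^q, with q = 2 for FE and q = 4 otherwise, has to beat a perturbation
    linear in a. Only even moments enter a, and those from 2 to q vanish once l + r >= q, so that a
    = O(t^(q+2)). *)

(** An n-th finite difference annihilates polynomials of degree below n: Pascal's rule trades one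
    unit of n for a first difference x^m - (x + 1)^m, of degree below m. The shift c will be -l. *)
Lemma alternating_bin_sum (R : comRingType) (n m : nat) (c : R) : (m < n)%N ->
  \sum_(i < n.+1) (-1) ^+ i * ('C(n, i))%:R * (i%:R + c) ^+ m = 0.
Proof.
elim: n m c => [//|n IHn] m c; rewrite ltnS => mn.
have -> : \sum_(i < n.+2) (-1) ^+ i * ('C(n.+1, i))%:R * (i%:R + c) ^+ m =
    \sum_(i < n.+1) (-1) ^+ i * ('C(n, i))%:R *
      ((i%:R + c) ^+ m - (i%:R + c + 1) ^+ m).
  under [RHS]eq_bigr => i _ do rewrite mulrBr.
  rewrite sumrB big_ord_recl /=.
  under eq_bigr => i _ do rewrite binS natrD mulrDr mulrDl.
  rewrite big_split /= addrA; congr (_ + _).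
    rewrite [in RHS]big_ord_recl /= !bin0; congr (_ + _).
    rewrite big_ord_recr /= bin_small // mulr0 mul0r addr0.
    by apply: eq_bigr.
  rewrite -sumrN; apply: eq_bigr => i _.
  rewrite /bump /= add1n exprS mulN1r !mulNr -natr1 -addrA [1 + c]addrC.
  by rewrite addrA.
have expand (x : R) : x ^+ m - (x + 1) ^+ m =
    - \sum_(j < m) ('C(m, j))%:R * x ^+ j.
  rewrite [x + 1]addrC exprDn big_ord_recr /= subnn expr0 binn mul1r mulr1n.
  rewrite opprD addrCA subrr addr0; congr (- _); apply: eq_bigr => j _.
  by rewrite expr1n mul1r mulr_natl.
under eq_bigr => i _ do rewrite expand mulrN mulr_sumr.
rewrite sumrN exchange_big /= big1 ?oppr0 // => j _.
under eq_bigr => i _ do rewrite mulrCA.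
by rewrite -mulr_sumr IHn ?mulr0 // (leq_trans (ltn_ord j)).
Qed.

Section Harmonic.
Variable (F : numFieldType).

(* With i = l + k this is (-1)^k l! r! / ((l + k)! (r - k)!), that is - k a_k for
   k <> 0. *)
Definition alt_bin_ratio (l r i : nat) : F :=
  (-1) ^+ (i + l) * ('C(l + r, i))%:R / ('C(l + r, l))%:R.

Lemma alt_bin_ratio_diag l r : alt_bin_ratio l r l = 1.
Proof.
rewrite /alt_bin_ratio addnn -signr_odd odd_double mul1r divff //.
by rewrite pnatr_eq0 -lt0n bin_gt0 leq_addr.
Qed.

Lemma sum_alt_bin_ratio l r m (c : F) : (m < l + r)%N ->
  \sum_(i < (l + r).+1) alt_bin_ratio l r i * (i%:R + c) ^+ m = 0.
Proof.
move=> mn; rewrite (eq_bigr (fun i : 'I_(l + r).+1 =>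
   (-1) ^+ l / ('C(l + r, l))%:R *
   ((-1) ^+ i * ('C(l + r, i))%:R * (i%:R + c) ^+ m))).
  by rewrite -mulr_sumr alternating_bin_sum ?mulr0.
by move=> i _; rewrite /alt_bin_ratio exprD; ring.
Qed.

(** The factor i - l cancels the denominator of the harmonic sum, so that passing from r to r + 1
    changes each term by a multiple of the ratio alone, whose sum is known. *)
Lemma alt_bin_ratioSr l r i : (i <= l + r.+1)%N ->
  alt_bin_ratio l r.+1 i - alt_bin_ratio l r i =
  alt_bin_ratio l r.+1 i * ((i%:R - l%:R) / r.+1%:R).
Proof.
move=> ir; rewrite /alt_bin_ratio !addnS.
have /(congr1 (fun k => k%:R : F)) := mul_bin_down (l + r).+1 i.
have /(congr1 (fun k => k%:R : F)) := mul_bin_down (l + r).+1 l.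
have lr : (l <= (l + r).+1)%N by rewrite -addnS leq_addr.
rewrite addnS in ir.
rewrite !natrM !natrB //= -!natr1 natrD.
have b0 : ('C(l + r, l))%:R != 0 :> F.
  by rewrite pnatr_eq0 -lt0n bin_gt0 leq_addr.
have b1 : ('C((l + r).+1, l))%:R != 0 :> F by rewrite pnatr_eq0 -lt0n bin_gt0.
have r0 : r%:R + 1 != 0 :> F by rewrite natr1 pnatr_eq0.
have n0 : l%:R + r%:R + 1 != 0 :> F by rewrite -natrD natr1 pnatr_eq0.
move: ('C(l + r, l))%:R b0 => x x0; move: ('C((l + r).+1, l))%:R b1 => y y0.
move=> h1 h2.
have -> : x = (l%:R + r%:R + 1 - l%:R) * y / (l%:R + r%:R + 1).
  by rewrite -h1; field.
have -> : ('C(l + r, i))%:R =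
    (l%:R + r%:R + 1 - i%:R) * ('C((l + r).+1, i))%:R /
    (l%:R + r%:R + 1) :> F.
  by rewrite -h2; field.
by field; rewrite y0 r0 n0.
Qed.

(** Raising l moves the centre of the stencil; shifting the index along with it keeps the offset i -
    l fixed. *)
Lemma alt_bin_ratioSl l r i : (i <= l + r)%N ->
  alt_bin_ratio l.+1 r i.+1 - alt_bin_ratio l r i =
  alt_bin_ratio l.+1 r i.+1 * ((l%:R - i%:R) / l.+1%:R).
Proof.
move=> ir; rewrite /alt_bin_ratio !addSn !addnS.
have /(congr1 (fun k => k%:R : F)) := mul_bin_diag (l + r).+1 i.
have /(congr1 (fun k => k%:R : F)) := mul_bin_diag (l + r).+1 l.
have lr : (l < (l + r).+1)%N by rewrite ltnS leq_addr.
rewrite !natrM /= -!natr1 natrD.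
have b0 : ('C(l + r, l))%:R != 0 :> F.
  by rewrite pnatr_eq0 -lt0n bin_gt0 leq_addr.
have b1 : ('C((l + r).+1, l.+1))%:R != 0 :> F.
  by rewrite pnatr_eq0 -lt0n bin_gt0.
have r0 : l%:R + 1 != 0 :> F by rewrite natr1 pnatr_eq0.
have n0 : l%:R + r%:R + 1 != 0 :> F by rewrite -natrD natr1 pnatr_eq0.
move: ('C(l + r, l))%:R b0 => x x0; move: ('C((l + r).+1, l.+1))%:R b1 => y y0.
move=> h1 h2.
have -> : x = (l%:R + 1) * y / (l%:R + r%:R + 1).
  by rewrite -h1; field.
have -> : ('C(l + r, i))%:R =
    (i%:R + 1) * ('C((l + r).+1, i.+1))%:R /
    (l%:R + r%:R + 1) :> F.
  by rewrite -h2; field.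
by rewrite !exprS !mulN1r !opprK; field; rewrite y0 r0 n0.
Qed.

(* Induction on r, then on l: the left-hand side changes by a full alternating sum
   with the diagonal term removed, that is by -1/(r+1), respectively 1/(l+1). *)
Lemma alt_bin_ratio_harmonic l r :
  \sum_(i < (l + r).+1 | i != l :> nat) alt_bin_ratio l r i / (i%:R - l%:R) =
  - \sum_(i < (l + r).+1 | i != l :> nat) (i%:R - l%:R)^-1.
Proof.
have sub0 (i l0 : nat) : i != l0 -> i%:R - l0%:R != 0 :> F.
  by rewrite subr_eq0 eqr_nat.
have sumD (l0 r0 : nat) : (0 < l0 + r0)%N ->
    \sum_(i < (l0 + r0).+1 | i != l0 :> nat) alt_bin_ratio l0 r0 i = -1.
  move=> n0; have := @sum_alt_bin_ratio l0 r0 0 0 n0.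
  have l0lt : (l0 < (l0 + r0).+1)%N by rewrite ltnS leq_addr.
  rewrite (bigD1 (Ordinal l0lt)) //= expr0 mulr1 alt_bin_ratio_diag.
  move/eqP; rewrite addrC addr_eq0 => /eqP <-.
  by apply: eq_bigr => i _; rewrite mulr1.
have stepr l0 r0 (f : nat -> F) :
   \sum_(i < (l0 + r0.+1).+1 | i != l0 :> nat) f i =
   \sum_(i < (l0 + r0).+1 | i != l0 :> nat) f i + f (l0 + r0.+1)%N.
  rewrite big_mkcond addnS big_ord_recr /= -big_mkcond.
  by rewrite -addnS gtn_eqF // -[X in (X < _)%N]addn0 ltn_add2l.
have stepl l0 r0 (f : nat -> F) :
   \sum_(i < (l0.+1 + r0).+1 | i != l0.+1 :> nat) f i =
   f 0%N + \sum_(i < (l0 + r0).+1 | i != l0 :> nat) f i.+1.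
  by rewrite big_mkcond addSn big_ord_recl /= [in RHS]big_mkcond.
elim: r l => [|r IHr] l; last first.
  have -> : \sum_(i < (l + r.+1).+1 | i != l :> nat)
        alt_bin_ratio l r.+1 i / (i%:R - l%:R) =
      \sum_(i < (l + r.+1).+1 | i != l :> nat)
        (alt_bin_ratio l r i / (i%:R - l%:R) +
         alt_bin_ratio l r.+1 i / r.+1%:R).
    apply: eq_bigr => i il.
    have := @alt_bin_ratioSr l r i (ltn_ord i).
    move/eqP; rewrite subr_eq => /eqP {1}->.
    have := sub0 _ _ il; set x := _ - l%:R => x0.
    by field; rewrite x0 nat1r pnatr_eq0.
  have n0 : (0 < l + r.+1)%N by rewrite addnS.
  rewrite big_split /= -mulr_suml (sumD _ _ n0).
  rewrite (stepr l r (fun i => alt_bin_ratio l r i / (i%:R - l%:R))).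
  rewrite (stepr l r (fun i => (i%:R - l%:R)^-1)) IHr.
  (* At the new last index the old binomial vanishes, while the harmonic sum gains 1/(r+1), which
     matches the -1/(r+1) coming from [sumD]. *)
  have -> : alt_bin_ratio l r (l + r.+1) = 0.
    by rewrite /alt_bin_ratio bin_small ?mulr0 ?mul0r // addnS.
  by rewrite natrD [l%:R + _]addrC addrK; field; rewrite nat1r pnatr_eq0.
elim: l => [|l IHl]; first by rewrite !big1 ?oppr0 // => i; rewrite ord1.
rewrite (stepl l 0%N (fun i => alt_bin_ratio l.+1 0 i / (i%:R - l.+1%:R))).
rewrite (stepl l 0%N (fun i => (i%:R - l.+1%:R)^-1)).
have -> : \sum_(i < (l + 0).+1 | i != l :> nat)
      alt_bin_ratio l.+1 0 i.+1 / (i.+1%:R - l.+1%:R) =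
    \sum_(i < (l + 0).+1 | i != l :> nat)
      (alt_bin_ratio l 0 i / (i%:R - l%:R) -
       alt_bin_ratio l.+1 0 i.+1 / l.+1%:R).
  apply: eq_bigr => i il.
  have := @alt_bin_ratioSl l 0 i (ltn_ord i).
  move/eqP; rewrite subr_eq => /eqP {1}->.
  have := sub0 _ _ il.
  by rewrite -!natr1 => x0; field; rewrite natr1 pnatr_eq0 x0.
rewrite sumrB -mulr_suml IHl.
(* The new index 0 has offset -(l+1), so its term is also a ratio divided by -(l+1) and completes
   the sum evaluated by [sumD]. *)
have := sumD l.+1 0%N (ltn0Sn _).
rewrite (stepl l 0%N (alt_bin_ratio l.+1 0)) => /eqP.
rewrite eq_sym [alt_bin_ratio _ _ _ + _]addrC -subr_eq => /eqP <-.
have shift (i : nat) : i.+1%:R - l.+1%:R = i%:R - l%:R :> F.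
  by rewrite -!natr1 opprD addrACA subrr addr0.
under [in RHS]eq_bigr => i _ do rewrite shift.
by field; rewrite ?(natr1, nat1r) pnatr_eq0.
Qed.

End Harmonic.

(** * Real matrices acting as complex scalars *)

Lemma le_mx_norm (R : realType) (m n : nat) (A : 'M[R]_(m.+1, n.+1)) i j :
  `|A i j| <= `|A|.
Proof.
rewrite [`|A|]mx_normrE.
exact: (le_bigmax 0 (fun ij : 'I_m.+1 * 'I_n.+1 => `|A ij.1 ij.2|) (i, j)).
Qed.

Lemma expr_unbounded (R : realType) (x C : R) :
  1 < x -> exists k : nat, C < x ^+ k.
Proof.
move=> x1.
have bernoulli (k : nat) : 1 + k%:R * (x - 1) <= x ^+ k.
  elim: k => [|k IH]; first by rewrite mul0r addr0 expr0.
  rewrite exprS; apply: (@le_trans _ _ (x * (1 + k%:R * (x - 1)))).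
    rewrite -natr1; have : 0 <= k%:R * (x - 1) ^+ 2.
      by rewrite mulr_ge0 // sqr_ge0.
    by nra.
  by rewrite ler_pM2l //; lra.
exists (Num.bound (C / (x - 1))).
apply: lt_le_trans (bernoulli _).
have x0 : 0 < x - 1 by lra.
have := unstable.ltr_bound (C / (x - 1)).
by rewrite ltr_pdivrMr // => h; lra.
Qed.

Section ActsAs.
Variables (R : realType) (n : nat) (u v : 'cV[R]_n.+1).

(* [X] acts on [u + i v] as multiplication by the complex number [a + i b]. *)
Definition acts_as (X : 'M[R]_n.+1) (a b : R) : Prop :=
  X *m u = a *: u - b *: v /\ X *m v = b *: u + a *: v.

Lemma acts_as1 : acts_as 1 1 0.
Proof. by split; rewrite mul1mx scale0r scale1r ?subr0 ?add0r. Qed.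

Lemma acts_as0 : acts_as 0 0 0.
Proof. by split; rewrite mul0mx !scale0r ?subr0 ?add0r. Qed.

Lemma acts_asD X Y a b c d :
  acts_as X a b -> acts_as Y c d -> acts_as (X + Y) (a + c) (b + d).
Proof.
move=> [Xu Xv] [Yu Yv]; split; rewrite mulmxDl ?Xu ?Xv ?Yu ?Yv !scalerDl.
  by rewrite opprD addrACA.
by rewrite addrACA.
Qed.

Lemma acts_asZ X a b c : acts_as X a b -> acts_as (c *: X) (c * a) (c * b).
Proof.
by move=> [Xu Xv]; split; rewrite -scalemxAl ?Xu ?Xv ?scalerBr ?scalerDr
  !scalerA.
Qed.

Lemma acts_asM X Y a b c d : acts_as X a b -> acts_as Y c d ->
  acts_as (X * Y) (a * c - b * d) (a * d + b * c).
Proof.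
move=> [Xu Xv] [Yu Yv]; split; rewrite -mulmxA ?Yu ?Yv;
  rewrite ?mulmxBr ?mulmxDr -!scalemxAr Xu Xv; apply/matrixP => i j;
  rewrite !mxE; ring.
Qed.

Lemma acts_as_sum (I : Type) (s : seq I) (X : I -> 'M[R]_n.+1) a b :
  (forall i, acts_as (X i) (a i) (b i)) ->
  acts_as (\sum_(i <- s) X i) (\sum_(i <- s) a i) (\sum_(i <- s) b i).
Proof.
move=> Xab; elim: s => [|i s IHs]; first by rewrite !big_nil; exact: acts_as0.
by rewrite !big_cons; exact: acts_asD.
Qed.

Lemma acts_asV X a b : X \is a GRing.unit -> a ^+ 2 + b ^+ 2 = 1 ->
  acts_as X a b -> acts_as X^-1 a (- b).
Proof.
move=> Xunit ab1 [Xu Xv].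
suff step (w z : 'cV_n.+1) : X *m w = z -> X^-1 *m z = w.
  split; apply: step; rewrite ?mulmxBr ?mulmxDr -!scalemxAr Xu Xv;
    apply/matrixP => i j; rewrite !mxE -[RHS]mul1r -ab1; ring.
by move=> <-; rewrite mulmxA -[X^-1 *m X]/(X^-1 * X) mulVr // mul1mx.
Qed.

(** With (a + ib)^k = c + id, the normalization at index 0 makes c and d the first entries of X^k u
    and X^k v. A bound on the powers of X would therefore bound c^2 + d^2 = (a^2 + b^2)^k. *)
Lemma acts_as_power_unbounded X a b : u 0 0 = 1 -> v 0 0 = 0 ->
  acts_as X a b -> 1 < a ^+ 2 + b ^+ 2 -> ~ power_bounded X.
Proof.
move=> u0 v0 Xab ab1 [C XC].
have Xk k : exists ab : R * R, acts_as (X ^+ k) ab.1 ab.2 /\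
    ab.1 ^+ 2 + ab.2 ^+ 2 = (a ^+ 2 + b ^+ 2) ^+ k.
  elim: k => [|k [[c d] /= [Xcd cd]]].
    exists (1, 0); rewrite !expr0 expr1n expr0n addr0.
    by split=> //; exact: acts_as1.
  exists (a * c - b * d, a * d + b * c).
  rewrite (exprS X) (exprS (_ + _)); split=> /=.
    exact: acts_asM.
  by rewrite -cd; ring.
have bound (Y : 'M[R]_n.+1) (w : 'cV[R]_n.+1) :
    `|(Y *m w) 0 0| <= `|Y| * \sum_i `|w i 0|.
  rewrite mxE (le_trans (ler_norm_sum _ _ _)) // mulr_sumr ler_sum // => i _.
  by rewrite normrM ler_wpM2r // le_mx_norm.
pose B := C * (\sum_i `|u i 0|); pose B' := C * (\sum_i `|v i 0|).
have [k Ck] := expr_unbounded (B ^+ 2 + B' ^+ 2) ab1.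
have [[c d] /= [[Xu Xv] cd]] := Xk k.
have cB : `|c| <= B.
  have := bound (X ^+ k) u; rewrite Xu !mxE u0 v0 mulr1 mulr0 subr0.
  by move/le_trans; apply; rewrite ler_wpM2r // sumr_ge0.
have dB : `|d| <= B'.
  have := bound (X ^+ k) v; rewrite Xv !mxE u0 v0 mulr1 mulr0 addr0.
  by move/le_trans; apply; rewrite ler_wpM2r // sumr_ge0.
move: Ck; rewrite -cd ltNge => /negP; apply.
rewrite -(real_normK (num_real c)) -(real_normK (num_real d)).
by rewrite lerD // lerXn2r // nnegrE // (le_trans _ cB, le_trans _ dB).
Qed.

End ActsAs.

(** * The lowest Fourier mode and the cyclic shift *)

Section Fourier.
Variables (R : realType) (n : nat).

Definition mesh_angle : R := pi *+ 2 / n.+1%:R.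
Let theta := mesh_angle.
Definition cos_vec : 'cV[R]_n.+1 := \col_i cos (i%:R * theta).
Definition sin_vec : 'cV[R]_n.+1 := \col_i sin (i%:R * theta).

(** Negative offsets use S^-1, a genuine inverse only for a unit; S is a permutation matrix,
    inverted by its transpose. *)
Lemma shift_mx_unit : shift_mx R n \is a GRing.unit.
Proof.
rewrite -[_ \is a _]/(shift_mx R n \in unitmx).
have /mulmx1_unit[] // : shift_mx R n *m (shift_mx R n)^T = 1%:M.
apply/matrixP => i j; rewrite !mxE (bigD1 (ordS i)) //= !mxE eqxx mul1r.
rewrite big1 ?addr0 => [|k ki]; last by rewrite !mxE (negbTE ki) mul0r.
by rewrite (inj_eq (@ordS_inj _)).
Qed.

Lemma shift_mulmx (w : 'cV[R]_n.+1) i : (shift_mx R n *m w) i 0 = w (ordS i) 0.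
Proof.
rewrite mxE (bigD1 (ordS i)) //= mxE eqxx mul1r big1 ?addr0 // => k ki.
by rewrite !mxE (negbTE ki) mul0r.
Qed.

(** The successor wraps around only at i = n, where the angle N theta is a full period. *)
Lemma ordS_angle (f : R -> R) (i : 'I_n.+1) : periodic f (pi *+ 2) ->
  f ((ordS i)%:R * theta) = f (theta + i%:R * theta).
Proof.
move=> fper; rewrite /= -[X in X + _]mul1r -mulrDl.
have [ltin|] := ltnP i n; first by rewrite modn_small // nat1r.
move=> nlei; have -> : i = n :> nat.
  by apply/eqP; rewrite eqn_leq nlei -ltnS ltn_ord.
rewrite modnn mul0r nat1r.
have -> : n.+1%:R * theta = 0 + pi *+ 2.
  by rewrite add0r mulrC divfK // pnatr_eq0.
by rewrite fper.
Qed.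

Lemma shift_acts_as :
  acts_as cos_vec sin_vec (shift_mx R n) (cos theta) (sin theta).
Proof.
split; apply/colP => i; rewrite shift_mulmx !mxE ordS_angle.
- by rewrite cosD.
- exact: cosD2pi.
- by rewrite sinD.
- exact: sinD2pi.
Qed.

Lemma shiftX_acts_as (k : int) :
  acts_as cos_vec sin_vec (shift_mx R n ^ k) (cos (k%:~R * theta))
    (sin (k%:~R * theta)).
Proof.
have nat_case (m : nat) : acts_as cos_vec sin_vec (shift_mx R n ^+ m)
    (cos (m%:R * theta)) (sin (m%:R * theta)).
  elim: m => [|m IHm].
    by rewrite mul0r cos0 sin0; exact: acts_as1.
  rewrite exprS -nat1r mulrDl mul1r cosD sinD [sin theta * cos _ + _]addrC.
  exact: (acts_asM shift_acts_as IHm).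
case: k => m; first exact: nat_case.
rewrite -[shift_mx R n ^ _]/((shift_mx R n ^+ m.+1)^-1).
rewrite NegzE mulrNz mulNr cosN sinN -pmulrn.
apply: acts_asV; last exact: nat_case.
  by rewrite unitrX // shift_mx_unit.
exact: cos2Dsin2.
Qed.

End Fourier.

(** * Taylor bounds *)

Lemma even_normrX (R : realDomainType) (x : R) n :
  ~~ odd n -> `|x| ^+ n = x ^+ n.
Proof. by move=> ev; rewrite -normrX ger0_norm ?exprn_even_ge0. Qed.

Section Taylor.
Variable R : realType.
Implicit Types x : R.

(** Plays the role of integration from 0: each trigonometric bound below has the preceding one as
    its derivative, starting from cos <= 1. *)
Lemma ge0_of_derive_ge0 (f df : R -> R) x :
  (forall z : R, is_derive z 1 f (df z)) -> f 0 = 0 ->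
  (forall z, 0 <= z -> 0 <= df z) -> 0 <= x -> 0 <= f x.
Proof.
move=> fdf f0 df0 x0; rewrite -f0.
apply: (@ger0_derive1_ndecry _ f 0) => //.
- move=> z; rewrite in_itv /= andbT => z0.
  by rewrite derive1E derive_val df0 // ltW.
- apply: continuous_subspaceT => z.
  by apply: differentiable_continuous; apply/derivable1_diffP.
Qed.

Lemma sin_le x : 0 <= x -> sin x <= x.
Proof.
move=> x0; rewrite -subr_ge0.
apply: (@ge0_of_derive_ge0 (fun z => z - sin z) (fun z => 1 - cos z)) => //.
by rewrite sin0 subr0.
Qed.

Lemma cos_ge2 x : 0 <= x -> 1 - x ^+ 2 / 2 <= cos x.
Proof.
move=> x0; rewrite -subr_ge0.
apply: (@ge0_of_derive_ge0 (fun z => cos z - (1 - z ^+ 2 / 2))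
  (fun z => z - sin z)) => //.
- by move=> z; apply: is_derive_eq; rewrite /GRing.scale /=; field.
- by rewrite cos0 expr0n mul0r subr0 subrr.
- by move=> z z0; rewrite subr_ge0 sin_le.
Qed.

Lemma sin_ge3 x : 0 <= x -> x - x ^+ 3 / 6 <= sin x.
Proof.
move=> x0; rewrite -subr_ge0.
apply: (@ge0_of_derive_ge0 (fun z => sin z - (z - z ^+ 3 / 6))
  (fun z => cos z - (1 - z ^+ 2 / 2))) => //.
- by move=> z; apply: is_derive_eq; rewrite /GRing.scale /=; field.
- by rewrite sin0 expr0n mul0r !subr0.
- by move=> z z0; rewrite subr_ge0 cos_ge2.
Qed.

Lemma cos_le4 x : 0 <= x -> cos x <= 1 - x ^+ 2 / 2 + x ^+ 4 / 24.
Proof.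
move=> x0; rewrite -subr_ge0.
apply: (@ge0_of_derive_ge0 (fun z => 1 - z ^+ 2 / 2 + z ^+ 4 / 24 - cos z)
  (fun z => sin z - (z - z ^+ 3 / 6))) => //.
- by move=> z; apply: is_derive_eq; rewrite /GRing.scale /=; field.
- by rewrite cos0 !expr0n !mul0r subr0 addr0 subrr.
- by move=> z z0; rewrite subr_ge0 sin_ge3.
Qed.

(** Only the power in the remainder matters later, so the coefficient 1 stands in for 1/120. *)
Lemma sin_le5 x : 0 <= x -> sin x <= x - x ^+ 3 / 6 + x ^+ 5.
Proof.
move=> x0; rewrite -subr_ge0.
apply: (@ge0_of_derive_ge0 (fun z => z - z ^+ 3 / 6 + z ^+ 5 - sin z)
  (fun z => 1 - z ^+ 2 / 2 + 5 * z ^+ 4 - cos z)) => //.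
- by move=> z; apply: is_derive_eq; rewrite /GRing.scale /=; field.
- by rewrite sin0 !expr0n !mul0r !subr0 addr0.
- by move=> z z0; have := cos_le4 z0; have := exprn_ge0 4 z0; lra.
Qed.

Lemma cos_ge6 x : 0 <= x -> 1 - x ^+ 2 / 2 + x ^+ 4 / 24 - x ^+ 6 <= cos x.
Proof.
move=> x0; rewrite -subr_ge0.
apply: (@ge0_of_derive_ge0
  (fun z => cos z - (1 - z ^+ 2 / 2 + z ^+ 4 / 24 - z ^+ 6))
  (fun z => z - z ^+ 3 / 6 + 6 * z ^+ 5 - sin z)) => //.
- by move=> z; apply: is_derive_eq; rewrite /GRing.scale /=; field.
- by rewrite cos0 !expr0n !mul0r !subr0 addr0 subrr.
- by move=> z z0; have := sin_le5 z0; have := exprn_ge0 5 z0; lra.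
Qed.

Lemma dist_cos_taylor2 x : `|cos x - (1 - x ^+ 2 / 2)| <= x ^+ 4 / 24.
Proof.
wlog x0 : x / 0 <= x => [hw|].
  have [/hw //|x0] := leP 0 x.
  have := hw (- x); rewrite cosN sqrrN.
  have -> : (- x) ^+ 4 = x ^+ 4 by ring.
  by apply; lra.
by rewrite ger0_norm ?subr_ge0 ?cos_ge2 //; have := cos_le4 x0; lra.
Qed.

Lemma dist_cos_taylor4 x :
  `|cos x - (1 - x ^+ 2 / 2 + x ^+ 4 / 24)| <= x ^+ 6.
Proof.
wlog x0 : x / 0 <= x => [hw|].
  have [/hw //|x0] := leP 0 x.
  have := hw (- x); rewrite cosN sqrrN.
  have -> : (- x) ^+ 4 = x ^+ 4 by ring.
  have -> : (- x) ^+ 6 = x ^+ 6 by ring.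
  by apply; lra.
rewrite ler0_norm ?subr_le0 ?cos_le4 //; have := cos_ge6 x0; lra.
Qed.

Lemma dist_sin_taylor1 x : `|sin x - x| <= `|x| ^+ 3 / 6.
Proof.
wlog x0 : x / 0 <= x => [hw|].
  have [/hw //|x0] := leP 0 x.
  by have := hw (- x); rewrite sinN -opprD !normrN; apply; lra.
rewrite ler0_norm ?subr_le0 ?sin_le // ger0_norm //; have := sin_ge3 x0; lra.
Qed.

Lemma expR_ge2 x : 0 <= x -> 1 + x + x ^+ 2 / 2 <= expR x.
Proof.
have ge1 (z : R) : 0 <= z -> 1 + z <= expR z by move=> _; exact: expR_ge1Dx.
move=> x0; rewrite -subr_ge0.
apply: (@ge0_of_derive_ge0 (fun z => expR z - (1 + z + z ^+ 2 / 2))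
  (fun z => expR z - (1 + z))) => //.
- by move=> z; apply: is_derive_eq; rewrite /GRing.scale /=; field.
- by rewrite expR0 expr0n mul0r !addr0 subrr.
- by move=> z z0; rewrite subr_ge0 ge1.
Qed.

(** The remainder x^k e^x has derivative k x^(k-1) e^x + x^k e^x, which dominates the preceding
    remainder; the bounds thus climb one degree at a time. *)
Lemma expR_le3 x : 0 <= x -> expR x <= 1 + x + x ^+ 2 / 2 + x ^+ 3 * expR x.
Proof.
have le1 (z : R) : 0 <= z -> 0 <= 1 + z * expR z - expR z.
  move=> z0; apply: (@ge0_of_derive_ge0 (fun z => 1 + z * expR z - expR z)
    (fun z => z * expR z)) => //.
  - by move=> w; apply: is_derive_eq; rewrite /GRing.scale /=; ring.
  - by rewrite expR0 mul0r addr0 subrr.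
  - by move=> w w0; exact: mulr_ge0 w0 (expR_ge0 w).
have le2 (z : R) : 0 <= z -> 0 <= 1 + z + z ^+ 2 * expR z - expR z.
  move=> z0.
  apply: (@ge0_of_derive_ge0 (fun z => 1 + z + z ^+ 2 * expR z - expR z)
    (fun z => 1 + z * expR z - expR z + (z * expR z + z ^+ 2 * expR z))) => //.
  - by move=> w; apply: is_derive_eq; rewrite /GRing.scale /=; ring.
  - by rewrite expR0 expr0n mul0r !addr0 subrr.
  - move=> w w0; apply: addr_ge0; first exact: le1.
    by apply: addr_ge0; apply: mulr_ge0; rewrite ?exprn_ge0 ?expR_ge0.
move=> x0; rewrite -subr_ge0.
apply: (@ge0_of_derive_ge0
  (fun z => 1 + z + z ^+ 2 / 2 + z ^+ 3 * expR z - expR z)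
  (fun z => 1 + z + z ^+ 2 * expR z - expR z +
     (2 * z ^+ 2 * expR z + z ^+ 3 * expR z))) => //.
- by move=> w; apply: is_derive_eq; rewrite /GRing.scale /=; field.
- by rewrite expR0 !expr0n !mul0r !addr0 subrr.
- move=> w w0; apply: addr_ge0; first exact: le2.
  by apply: addr_ge0; do !apply: mulr_ge0; rewrite ?exprn_ge0 ?expR_ge0.
Qed.

End Taylor.

(** * Stability polynomials *)

Lemma class_C_cst (R : realType) (U V : normedModType R) (c : V) k :
  class_C k (cst c : U -> V).
Proof.
elim: k c => [|k IH] c; first by split=> //; exact: cst_continuous.
split; first exact: cst_continuous.
move=> v; split; first by move=> x; exact: derivable_cst.
have -> : 'D_v (cst c : U -> V) = cst 0 by apply/funext => x; exact: derive_cst.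
exact: IH.
Qed.

(** Smoothness of the right-hand side of the test equation y' = y: a linear map has constant
    directional derivatives. *)
Lemma smooth_snd (R : realType) (U V : normedModType R) :
  smooth (fun x : U * V => x.2).
Proof.
have snd_cont : continuous (fun x : U * V => x.2) by move=> x; exact: cvg_snd.
case=> [|k]; first by split.
split=> // v; split=> [x|].
  apply: diff_derivable; exact: (@linear_differentiable _ _ _ (@snd U V)).
have -> : 'D_v (fun x : U * V => x.2) = cst v.2; last exact: class_C_cst.
apply/funext => x; rewrite deriveE.
  by rewrite (@diff_lin _ _ _ (@snd U V)).
exact: (@linear_differentiable _ _ _ (@snd U V)).
Qed.

Lemma is_derive_const_mx_expR (R : realType) (m n : nat) (t : R) :
  is_derive t (1 : R) (fun t : R => const_mx (expR t) : 'M[R]_(m.+1, n.+1))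
    (const_mx (expR t)).
Proof.
have der : derivable (fun t : R => const_mx (expR t) : 'M[R]_(m.+1, n.+1)) t 1.
  apply/derivable_mxP => i j.
  have -> : (fun x : R => (const_mx (expR x) : 'M[R]_(m.+1, n.+1)) i j) = expR.
    by apply/funext => x; rewrite mxE.
  exact: ex_derive.
split=> //; rewrite derive_mx //; apply/matrixP => i j; rewrite !mxE.
have -> : (fun x : R => (const_mx (expR x) : 'M[R]_(m.+1, n.+1)) i j) = expR.
  by apply/funext => x; rewrite mxE.
exact: derive_val.
Qed.

Lemma rk_stagesE (R : realType) (V : lmodType R) (s : nat) (m : butcher R s)
    (f : R -> V -> V) (t dt : R) (y : V) i : explicit_rk m ->
  rk_stages m f t dt y i =
  f (t + rk_node m i * dt)
    (y + dt *: \sum_(j < s) rk_coef m i j *: rk_stages m f t dt y j).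
Proof. by move=> me; rewrite -{1}(rk_stagesP f t dt y me). Qed.

Lemma rk_step2 (R : realType) (V : lmodType R) (m : butcher R 2)
    (f : R -> V -> V) (t dt : R) (y : V) : explicit_rk m ->
  let k0 := f (t + rk_node m 0 * dt) y in
  let k1 := f (t + rk_node m 1 * dt) (y + dt *: (rk_coef m 1 0 *: k0)) in
  rk_step m f t dt y = y + dt *: (rk_weight m 0 *: k0 + rk_weight m 1 *: k1).
Proof.
move=> me k0 k1; rewrite /rk_step.
have e1 : lift ord0 ord0 = 1 :> 'I_2 by apply/val_inj.
have E0 : rk_stages m f t dt y 0 = k0.
  by rewrite rk_stagesE // big1 ?scaler0 ?addr0 // => j _; rewrite me ?scale0r.
have E1 : rk_stages m f t dt y 1 = k1.
  rewrite rk_stagesE // !big_ord_recl big_ord0 e1 E0 (me 1 1) //.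
  by rewrite scale0r !addr0.
by rewrite !big_ord_recl big_ord0 e1 E0 E1 addr0.
Qed.

Lemma small_eq0 (R : realType) (c K d : R) : 0 < d ->
  (forall x, 0 < x -> x < d -> `|c| <= K * x) -> c = 0.
Proof.
move=> d0 cK; apply/eqP; rewrite -normr_le0; apply/ler_addgt0Pl => e e0.
rewrite addr0.
pose x := Num.min (d / 2) (e / (`|K| + 1)).
have K0 := normr_ge0 K.
have x0 : 0 < x by rewrite lt_min !divr_gt0 //; lra.
have xd : x < d by rewrite gt_min; apply/orP; left; lra.
have xe : x * (`|K| + 1) <= e.
  by rewrite -ler_pdivlMr ?ge_min ?lexx ?orbT //; lra.
have := cK x x0 xd; have := ler_norm K; nra.
Qed.

(* The order condition is tested on the scalar equation y' = y. *)
Lemma RK2_coef (R : realType) (m : butcher R 2) : is_RK2 m ->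
  rk_weight m 0 + rk_weight m 1 = 1 /\ rk_weight m 1 * rk_coef m 1 0 = 1 / 2.
Proof.
case=> me mo.
pose f (_ : R) (y : 'rV[R]_1) := y.
pose y (t : R) : 'rV[R]_1 := const_mx (expR t).
have := mo 0 f (@smooth_snd R R 'rV[R]_1) y 0.
have yder : \forall t \near (0 : R), is_derive (t : R) (1 : R) y (f t (y t)).
  by apply: (filterE (F := nbhs (0 : R))) => t; exact: is_derive_const_mx_expR.
move=> /(_ yder) /eqO_exP [K K0 nearK].
pose b0 := rk_weight m 0; pose b1 := rk_weight m 1; rewrite -/b0 -/b1.
pose a := rk_coef m 1 0; rewrite -/a.
have [d d0 dK] : exists2 d : R, 0 < d & forall x, 0 < x -> x < d ->
    `|expR x - (1 + (b0 + b1) * x + b1 * a * x ^+ 2)| <= K * x ^+ 3.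
  have [d /= d0 dP] := nearK; exists d => // x x0 xd.
  have := dP x; rewrite /ball_ /= sub0r normrN gtr0_norm // => /(_ xd x0).
  rewrite normrX (gtr0_norm x0); apply: le_trans.
  apply: le_trans (le_mx_norm _ 0 0).
  rewrite rk_step2 // !mxE add0r expR0 /f /= -/b0 -/b1 -/a le_eqVlt.
  by apply/orP; left; apply/eqP; congr `|_|; ring.
have e3 : expR 1 > 0 :> R by exact: expR_gt0.
(* For x < 1 the exponential differs from its quadratic Taylor polynomial by at most e x^3.
   Subtracting leaves the mismatch of the coefficients of x and x^2, and one factor x is divided
   out. *)
have small x : 0 < x -> x < Num.min d 1 ->
    `|(b0 + b1 - 1) + (b1 * a - 1 / 2) * x| <= (K + expR 1) * x ^+ 2.
  move=> x0; rewrite lt_min => /andP[xd x1].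
  have := dK x x0 xd.
  have := expR_ge2 (ltW x0); have := expR_le3 (ltW x0).
  have : expR x <= expR 1 by rewrite ler_expR ltW.
  move=> xe e2 e1 h.
  rewrite -(ler_pM2r x0) -[X in _ * X <= _](gtr0_norm x0) -normrM.
  rewrite -mulrA -exprSr.
  set u := _ * x.
  have -> : u = (expR x - (1 + x + x ^+ 2 / 2)) -
     (expR x - (1 + (b0 + b1) * x + b1 * a * x ^+ 2)) by rewrite /u; field.
  apply: le_trans (ler_normB _ _) _.
  rewrite [(K + _) * _]mulrDl addrC lerD // ger0_norm; last by lra.
  have : x ^+ 3 * expR x <= x ^+ 3 * expR 1 by rewrite ler_pM2l // exprn_gt0.
  lra.
have d1 : 0 < Num.min d 1 by rewrite lt_min d0 ltr01.
(* Moving the linear mismatch to the right, with x^2 <= x, isolates the constant one. Once that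
   vanishes, a further division by x isolates the linear one. *)
have b01 : b0 + b1 - 1 = 0.
  apply: (@small_eq0 _ _ (K + expR 1 + `|b1 * a - 1 / 2|) _ d1) => x x0 xd.
  have := small x x0 xd; move: (b0 + b1 - 1) (b1 * a - 1 / 2) => p q h.
  have : `|p| <= `|p + q * x| + `|q * x|.
    by rewrite -{1}(addrK (q * x) p) ler_normB.
  move: xd; rewrite lt_min normrM (gtr0_norm x0) => /andP[_ x1].
  by move=> h2; have : x ^+ 2 <= x by [rewrite expr2 ger_pMl ?ltW]; nra.
split; first lra.
apply/eqP; rewrite -subr_eq0; apply/eqP.
apply: (@small_eq0 _ _ (K + expR 1) _ d1) => x x0 xd.
have := small x x0 xd; rewrite b01 add0r normrM (gtr0_norm x0) expr2 mulrA.
by rewrite ler_pM2r.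
Qed.

Lemma stability_poly_RK2 (R : realType) (m : butcher R 2) : is_RK2 m ->
  stability_poly m = 1 + 'X + (1 / 2) *: 'X ^+ 2.
Proof.
move=> mRK2; have [b01 b1a] := RK2_coef mRK2; case: mRK2 => me _.
rewrite /stability_poly rk_step2 // !scale1r mulr1.
set b0 := rk_weight m 0 in b01 *; set b1 := rk_weight m 1 in b01 b1a *.
rewrite mulrDr mulr1 -scalerAr -expr2 scalerDr scalerA b1a !addrA.
by rewrite -(addrA 1 (b0 *: 'X)) -scalerDl b01 scale1r.
Qed.

Lemma stability_poly_FE (R : realType) : stability_poly (FE R) = 1 + 'X.
Proof.
rewrite /stability_poly /rk_step /rk_stages /= /rk_slopes !big_ord_recl
  !big_ord0 /=.
by rewrite mxE !scale0r !addr0 !scale1r !addr0 mulr1.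
Qed.

Lemma LSRK3_explicit (R : realType) : explicit_rk (LSRK3 R).
Proof.
by move=> [[|[|[|[|//]]]] ?] [[|[|[|[|//]]]] ?] //= _; rewrite mxE.
Qed.

Lemma stability_poly_LSRK3 (R : realType) : stability_poly (LSRK3 R) =
  1 + 'X + (1 / 2) *: 'X ^+ 2 + (1 / 6) *: 'X ^+ 3 + (1 / 12) *: 'X ^+ 4.
Proof.
rewrite /stability_poly /rk_step.
set k := rk_stages _ _ _ _ _.
have kE i : k i = 'X * (1 + \sum_(j < 4) rk_coef (LSRK3 R) i j *: k j).
  by rewrite {1}/k rk_stagesE ?scale1r //; exact: LSRK3_explicit.
pose i1 : 'I_4 := lift ord0 ord0.
pose i2 : 'I_4 := lift ord0 (lift ord0 ord0).
pose i3 : 'I_4 := lift ord0 (lift ord0 (lift ord0 ord0)).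
have E0 : k ord0 = 'X.
  by rewrite kE !big_ord_recl big_ord0 !mxE /= !scale0r !addr0 mulr1.
have E1 : k i1 = 'X * (1 + (1 / 2) *: 'X).
  by rewrite kE !big_ord_recl big_ord0 !mxE /= !scale0r !addr0 E0.
have E2 : k i2 = 'X * (1 + k i1).
  by rewrite kE !big_ord_recl big_ord0 !mxE /= !scale0r !addr0 add0r scale1r.
have E3 : k i3 = 'X * (1 + k i2).
  by rewrite kE !big_ord_recl big_ord0 !mxE /= !scale0r !addr0 !add0r scale1r.
rewrite !big_ord_recl big_ord0 /= -/i1 -/i2 -/i3.
rewrite E3 E2 E1 E0 scale0r add0r addr0 scale1r.
rewrite -!mul_polyC.
(* Polynomials form only a ring, so every rational weight is expressed through p = 1/6 and the
   single relation 6 p = 1; the two sides then differ by a multiple of 6 p - 1. *)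
have -> : (2 / 3)%:P = 4 * (1 / 6)%:P :> {poly R}.
  by rewrite -[4]polyC_natr -polyCM; congr (_%:P); field.
have -> : (1 / 2)%:P = 3 * (1 / 6)%:P :> {poly R}.
  by rewrite -[3]polyC_natr -polyCM; congr (_%:P); field.
have -> : (1 / 12)%:P = 3 * (1 / 6)%:P ^+ 2 :> {poly R}.
  by rewrite -[3]polyC_natr -polyC_exp -polyCM; congr (_%:P); field.
have : 6 * (1 / 6)%:P = 1 :> {poly R}.
  by rewrite -[6]polyC_natr -polyCM -[RHS]polyC1; congr (_%:P); field.
move: (1 / 6)%:P => p p6; apply/eqP; rewrite -subr_eq0; apply/eqP.
transitivity ((6 * p - 1) * ('X + 2 * p * 'X^2)); first by ring.
by rewrite p6 subrr mul0r.
Qed.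

(** * The symbol of the finite-difference operator *)

Section Coefficients.
Variables (R : realType) (l r : nat).

Definition offset (i : nat) : R := (stencil l i)%:~R.

Lemma offsetE i : offset i = i%:R - l%:R.
Proof. by rewrite /offset /stencil rmorphB. Qed.

Lemma stencil_eq0 i : (stencil l i == 0) = (i == l).
Proof. by rewrite subr_eq0. Qed.

Lemma offset_eq0 i : (offset i == 0) = (i == l).
Proof. by rewrite /offset intr_eq0 stencil_eq0. Qed.

Lemma fd_coefE i : (i <= l + r)%N -> i != l ->
  fd_coef R l r (stencil l i) = - (alt_bin_ratio R l r i / offset i).
Proof.
move=> ilr il; rewrite /fd_coef stencil_eq0 (negbTE il) -/(offset i).
have -> : absz (l%:Z + stencil l i) = i by rewrite /stencil addrC subrK.
have -> : absz (r%:Z - stencil l i) = (l + r - i)%N.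
  by rewrite /stencil opprB addrA -PoszD addnC subzn.
have -> : (-1) ^ stencil l i = (-1) ^+ (i + l) :> R.
  rewrite /stencil expfzDr ?oppr_eq0 ?oner_eq0 // exprD; congr (_ * _).
  by rewrite -exprz_inv invrN1.
have nz k : (k`!)%:R != 0 :> R by rewrite pnatr_eq0 -lt0n fact_gt0.
have o0 : offset i != 0 by rewrite offset_eq0.
have bi := bin_fact ilr; have bl := bin_fact (leq_addr r l).
rewrite addKn in bl.
have /(congr1 (fun k => k%:R : R)) := etrans bi (esym bl).
rewrite !natrM /alt_bin_ratio.
have b0 : ('C(l + r, l))%:R != 0 :> R.
  by rewrite pnatr_eq0 -lt0n bin_gt0 leq_addr.
move: (nz i) (nz (l + r - i)%N) b0 o0.
move: ('C(l + r, l))%:R ('C(l + r, i))%:R => x y i0 k0 x0 o0 yx.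
have -> : (l`!)%:R * (r`!)%:R = y * ((i`!)%:R * ((l + r - i)`!)%:R) / x.
  by rewrite yx [RHS]mulrC mulKf.
by field; rewrite o0 i0 k0 x0.
Qed.

(** This is where the value of a_0 enters: by the harmonic identity it is minus the sum of the other
    coefficients. *)
Lemma sum_fd_coef : \sum_(i < (l + r).+1) fd_coef R l r (stencil l i) = 0.
Proof.
have ll : (l < (l + r).+1)%N by rewrite ltnS leq_addr.
rewrite (bigD1 (Ordinal ll)) //= {1}/fd_coef stencil_eq0 eqxx.
rewrite [X in _ + X](eq_bigr (fun i : 'I__ =>
  - (alt_bin_ratio R l r i / (i%:R - l%:R)))).
  rewrite sumrN [X in _ - X](_ : _ =
      - \sum_(i < (l + r).+1 | i != l :> nat) (i%:R - l%:R)^-1); last first.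
    exact: alt_bin_ratio_harmonic.
  rewrite opprK addrC; apply/eqP; rewrite subr_eq0.
  apply/eqP; apply: eq_big => [i|i _]; first by rewrite stencil_eq0.
  by rewrite -offsetE.
by move=> i il; rewrite fd_coefE ?offsetE // -ltnS.
Qed.

(** Since k a_k is minus the alternating ratio for k <> 0, the sum is minus a vanishing finite
    difference deprived of its diagonal term 0^m, which is 1 exactly when m = 0. *)
Lemma fd_coef_moment m : (m < l + r)%N ->
  \sum_(i < (l + r).+1) fd_coef R l r (stencil l i) * offset i ^+ m.+1 =
  (m == 0%N)%:R.
Proof.
move=> mlr; have ll : (l < (l + r).+1)%N by rewrite ltnS leq_addr.
have := sum_alt_bin_ratio (- l%:R : R) mlr.
rewrite (bigD1 (Ordinal ll)) //= [in X in _ -> X](bigD1 (Ordinal ll)) //=.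
rewrite -!offsetE.
have -> : offset l = 0 by apply/eqP; rewrite offset_eq0.
rewrite alt_bin_ratio_diag mul1r expr0n exprS mul0r mulr0 add0r => /eqP.
rewrite addrC addr_eq0 => /eqP h.
rewrite -[RHS]opprK -h -sumrN; apply: eq_bigr => i il.
rewrite fd_coefE //; last by rewrite -ltnS.
rewrite -!offsetE exprS mulrA mulNr divfK ?mulNr //.
by rewrite offset_eq0.
Qed.

Definition fd_symbol_re (t : R) : R :=
  \sum_(i < (l + r).+1) fd_coef R l r (stencil l i) * cos (offset i * t).

Definition fd_symbol_im (t : R) : R :=
  \sum_(i < (l + r).+1) fd_coef R l r (stencil l i) * sin (offset i * t).

(** The constant does not depend on t: the stencil is finite, and the powers of the offsets are
    absorbed into it. *)
Lemma fd_sum_taylor (g T : R -> R) (e : R) (k : nat) (c t : R) :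
  (forall x, `|g x - T x| <= e * `|x| ^+ k) ->
  \sum_(i < (l + r).+1) fd_coef R l r (stencil l i) * T (offset i * t) = c ->
  `|\sum_(i < (l + r).+1) fd_coef R l r (stencil l i) * g (offset i * t) - c|
   <= (e * \sum_(i < (l + r).+1)
         `|fd_coef R l r (stencil l i)| * `|offset i| ^+ k) * `|t| ^+ k.
Proof.
move=> gT <-; rewrite -sumrB (le_trans (ler_norm_sum _ _ _)) //.
rewrite mulr_sumr mulr_suml ler_sum // => i _.
rewrite -mulrBr normrM mulrCA -mulrA ler_wpM2l // -mulrA.
by rewrite -exprMn -normrM.
Qed.

Lemma fd_symbol_re_O4 : (2 <= l + r)%N ->
  exists C, forall t, `|fd_symbol_re t| <= C * `|t| ^+ 4.
Proof.
move=> lr; eexists => t; rewrite -[fd_symbol_re t]subr0.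
apply: (@fd_sum_taylor _ (fun x => 1 - x ^+ 2 / 2) 24^-1).
  move=> x; have -> : `|x| ^+ 4 = x ^+ 4 by rewrite even_normrX.
  by rewrite [24^-1 * _]mulrC; exact: dist_cos_taylor2.
rewrite (eq_bigr (fun i : 'I__ => fd_coef R l r (stencil l i) -
   t ^+ 2 / 2 * (fd_coef R l r (stencil l i) * offset i ^+ 2))); last first.
  by move=> i _; field.
by rewrite sumrB -mulr_sumr sum_fd_coef fd_coef_moment // mulr0 subr0.
Qed.

Lemma fd_symbol_re_O6 : (4 <= l + r)%N ->
  exists C, forall t, `|fd_symbol_re t| <= C * `|t| ^+ 6.
Proof.
move=> lr; eexists => t; rewrite -[fd_symbol_re t]subr0.
apply: (@fd_sum_taylor _ (fun x => 1 - x ^+ 2 / 2 + x ^+ 4 / 24) 1).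
  move=> x; have -> : `|x| ^+ 6 = x ^+ 6 by rewrite even_normrX.
  by rewrite mul1r; exact: dist_cos_taylor4.
rewrite (eq_bigr (fun i : 'I__ => fd_coef R l r (stencil l i) -
   t ^+ 2 / 2 * (fd_coef R l r (stencil l i) * offset i ^+ 2) +
   t ^+ 4 / 24 * (fd_coef R l r (stencil l i) * offset i ^+ 4))); last first.
  by move=> i _; field.
rewrite big_split sumrB -!mulr_sumr sum_fd_coef !fd_coef_moment //=.
  by rewrite !mulr0 subr0 addr0.
by rewrite (leq_trans _ lr).
Qed.

Lemma fd_symbol_im_O3 : (1 <= l + r)%N ->
  exists C, forall t, `|fd_symbol_im t - t| <= C * `|t| ^+ 3.
Proof.
move=> lr; eexists => t; apply: (@fd_sum_taylor _ (fun x => x) 6^-1).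
  by move=> x; rewrite mulrC; exact: dist_sin_taylor1.
under eq_bigr => i _ do rewrite mulrA -[offset i]expr1.
by rewrite -mulr_suml fd_coef_moment // mul1r.
Qed.

Lemma semidiscrete_acts_as n :
  acts_as (cos_vec R n) (sin_vec R n) (semidiscrete_mx R l r n)
    (- fd_symbol_re (mesh_angle R n)) (- fd_symbol_im (mesh_angle R n)).
Proof.
rewrite /semidiscrete_mx -scaleN1r -(mulN1r (fd_symbol_re _)).
rewrite -(mulN1r (fd_symbol_im _)).
apply: acts_asZ; apply: acts_as_sum => i; apply: acts_asZ.
exact: shiftX_acts_as.
Qed.

End Coefficients.

Lemma mesh_angle_small (R : realType) (d : R) : 0 < d ->
  \forall n \near \oo, 0 < mesh_angle R n < d.
Proof.
move=> d0; have p0 : 0 < pi *+ 2 :> R by rewrite pmulrn_lgt0 ?pi_gt0.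
have e0 : 0 < d / (pi *+ 2) by rewrite divr_gt0.
have := near_infty_natSinv_lt (PosNum e0); apply: filterS => n /= h.
by rewrite /mesh_angle divr_gt0 //= mulrC -ltr_pdivlMr.
Qed.

(* As the mesh is refined, the lowest nonconstant mode gives the eigenvalue
   [a + i b] of [mu_c M] close to the imaginary axis. *)
Lemma unstable_of_near_imaginary (R : realType) (s : nat) (m : butcher R s)
    (l r q : nat) (mu eps : R) : 0 < mu -> 0 < eps -> (1 <= l + r)%N ->
  (exists C, forall t : R, `|fd_symbol_re l r t| <= C * `|t| ^+ q.+2) ->
  (forall n (u v : 'cV[R]_n.+1) (X : 'M[R]_n.+1) (a b : R),
    acts_as u v X a b -> b != 0 -> `|b| <= 1 -> `|a| <= eps * `|b| ^+ q ->
    exists c d, acts_as u v (horner_mx X (stability_poly m)) c d /\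
      1 < c ^+ 2 + d ^+ 2) ->
  unstable_in_the_limit m l r mu.
Proof.
move=> mu0 eps0 lr [C1 reC] amp.
have [C2 imC] := @fd_symbol_im_O3 R l r lr.
pose K1 : R := `|C1| + 1; pose K2 : R := `|C2| + 1.
have K10 : 0 < K1 by rewrite ltr_pwDr.
have K20 : 0 < K2 by rewrite ltr_pwDr.
(* The condition t < [e1] says that mu K1 t < eps (mu/2)^q, where mu t / 2 is a lower bound for
   |b|. *)
pose e1 := eps * (mu / 2) ^+ q / (mu * K1).
have e10 : 0 < e1 by rewrite divr_gt0 ?mulr_gt0 ?exprn_gt0 // divr_gt0.
(* The bound 1/(2 K2) keeps the imaginary symbol between t/2 and 2t, and 1/(2 mu) then gives |b| <=
   1. *)
pose d := Num.min (Num.min 1 (2 * K2)^-1) (Num.min (2 * mu)^-1 e1).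
have d0 : 0 < d by rewrite !lt_min ltr01 e10 !invr_gt0 !mulr_gt0.
have := mesh_angle_small d0; apply: filterS => n.
rewrite !lt_min => /andP[t0 /andP[/andP[t1 tK2] /andP[tmu te1]]].
rewrite /= /fd_unstable /fully_discrete_mx mulfK; last first.
  by rewrite invr_eq0 pnatr_eq0.
have := acts_asZ mu (@semidiscrete_acts_as R l r n).
move: (mesh_angle R n) t0 t1 tK2 tmu te1 => t t0 t1 tK2 tmu te1 act.
have t2 : t ^+ 2 <= t by rewrite expr2 ger_pMl // ltW.
have im_t : `|fd_symbol_im l r t - t| <= t / 2.
  apply: le_trans (imC t) _; rewrite (gtr0_norm t0) exprS mulrCA ler_pM2l //.
  have : C2 * t ^+ 2 <= K2 * t.
    have : C2 * t ^+ 2 <= `|C2| * t ^+ 2.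
      by rewrite ler_wpM2r ?sqr_ge0 ?ler_norm.
    have : `|C2| * t ^+ 2 <= `|C2| * t by rewrite ler_wpM2l.
    by rewrite /K2 mulrDl; lra.
  move: tK2; rewrite -[_^-1]mul1r ltr_pdivlMr ?mulr_gt0 // => h1 h2; lra.
have [im_lo im_hi] : t / 2 <= fd_symbol_im l r t /\ fd_symbol_im l r t <= 2 * t.
  by move: im_t; rewrite ler_distl => /andP[]; split; lra.
have im0 : 0 < fd_symbol_im l r t by lra.
have re_t : `|fd_symbol_re l r t| <= K1 * t ^+ q.+2.
  apply: le_trans (reC t) _; rewrite (gtr0_norm t0) ler_wpM2r //.
    by rewrite exprn_ge0 // ltW.
  by rewrite (le_trans (ler_norm _)) // lerDl.
have absb : `|mu * - fd_symbol_im l r t| = mu * fd_symbol_im l r t.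
  by rewrite mulrN normrN gtr0_norm // mulr_gt0.
have b_neq0 : mu * - fd_symbol_im l r t != 0.
  by rewrite -normr_gt0 absb mulr_gt0.
have b_le1 : `|mu * - fd_symbol_im l r t| <= 1.
  rewrite absb; move: tmu; rewrite -[_^-1]mul1r ltr_pdivlMr ?mulr_gt0 // => h.
  have : mu * fd_symbol_im l r t <= mu * (2 * t) by rewrite ler_pM2l.
  lra.
have a_small : `|mu * - fd_symbol_re l r t| <=
    eps * `|mu * - fd_symbol_im l r t| ^+ q.
  rewrite absb mulrN normrN normrM (gtr0_norm mu0).
  have h : mu * K1 * t <= eps * (mu / 2) ^+ q.
    by move: te1; rewrite /e1 ltr_pdivlMr ?mulr_gt0 // mulrC => /ltW.
  (* Of the q + 2 powers of t in the bound for a, one is spent on t < [e1] and another on t < 1; the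
     remaining t^q is compared with |b|^q. *)
  apply: (@le_trans _ _ (eps * (mu / 2) ^+ q * t ^+ q)).
    apply: (@le_trans _ _ (mu * (K1 * t ^+ q.+2))); first by rewrite ler_pM2l.
    have -> : mu * (K1 * t ^+ q.+2) = (mu * K1 * t) * (t * t ^+ q).
      by rewrite !exprS; ring.
    have tq : 0 < t ^+ q by rewrite exprn_gt0.
    have p1 : 0 <= mu * K1 * t by apply/ltW; rewrite !mulr_gt0.
    have p2 : 0 <= t * t ^+ q by apply/ltW; rewrite mulr_gt0.
    by rewrite ler_pM // ger_pMl // ltW.
  rewrite -mulrA -exprMn ler_pM2l // lerXn2r // ?nnegrE.
  - by rewrite mulr_ge0 // ltW // divr_gt0.
  - by rewrite mulr_ge0 // ltW.
  - by rewrite mulrAC -mulrA ler_pM2l.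
have [c [d' [act' gt1]]] := amp _ _ _ _ _ _ act b_neq0 b_le1 a_small.
apply: acts_as_power_unbounded act' gt1.
- by rewrite mxE mul0r cos0.
- by rewrite mxE mul0r sin0.
Qed.

(** * Amplification near the imaginary axis *)

Section Amplification.
Variable R : realType.
Implicit Types a b : R.

Lemma FE_amplification a b : b != 0 -> `|a| <= 4^-1 * `|b| ^+ 2 ->
  1 < (1 + a) ^+ 2 + (0 + b) ^+ 2.
Proof.
move=> b0; rewrite real_normK ?num_real // ler_norml => /andP[a1 _].
have : 0 < b ^+ 2 by rewrite exprn_even_gt0 ?b0 ?orbT.
have : 0 <= a ^+ 2 by exact: sqr_ge0.
by lra.
Qed.

(** Charges every monomial of |p_s(a + ib)|^2 that contains a to |a|, which makes the amplification
    estimates linear. *)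
Lemma norm_monomial_le a b i j : `|a| <= 1 -> `|b| <= 1 -> (0 < i)%N ->
  `|a ^+ i * b ^+ j| <= `|a|.
Proof.
case: i => // i a1 b1 _; rewrite exprS -mulrA normrM ler_piMr // normrM !normrX.
by rewrite mulr_ile1 ?exprn_ile1 ?exprn_ge0.
Qed.

Lemma RK2_amplification a b : b != 0 -> `|b| <= 1 ->
  `|a| <= 32^-1 * `|b| ^+ 4 ->
  1 < (1 + a + 1 / 2 * (a * a - b * b)) ^+ 2 +
      (0 + b + 1 / 2 * (a * b + b * a)) ^+ 2.
Proof.
move=> b0 b1; rewrite even_normrX // => ab.
have b40 : 0 < b ^+ 4 by rewrite exprn_even_gt0 ?b0 ?orbT.
have b41 : b ^+ 4 <= 1 by rewrite -even_normrX // exprn_ile1.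
have a1 : `|a| <= 1 by lra.
have lo i j : (0 < i)%N -> - `|a| <= a ^+ i * b ^+ j.
  by move=> i0; have := norm_monomial_le j a1 b1 i0;
    rewrite ler_norml => /andP[].
have m1 := lo 1 0 isT; have m2 := lo 2 0 isT; have m3 := lo 3 0 isT.
have m4 := lo 4 0 isT; have m5 := lo 1 2 isT; have m6 := lo 2 2 isT.
(* The coefficients of the monomials containing a sum to 27/4, which is less than 32/4; hence the
   constant 1/32 against the gain b^4/4. *)
by move: `|a| ab m1 m2 m3 m4 m5 m6 => al; clear -b40; lra.
Qed.

Lemma LSRK3_amplification a b (c2 := a * a - b * b) (d2 := a * b + b * a)
  (c3 := a * c2 - b * d2) (d3 := a * d2 + b * c2)
  (c4 := a * c3 - b * d3) (d4 := a * d3 + b * c3) :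
  b != 0 -> `|b| <= 1 -> `|a| <= 300^-1 * `|b| ^+ 4 ->
  1 < (1 + a + 1 / 2 * c2 + 1 / 6 * c3 + 1 / 12 * c4) ^+ 2 +
      (0 + b + 1 / 2 * d2 + 1 / 6 * d3 + 1 / 12 * d4) ^+ 2.
Proof.
move=> b0 b1; rewrite even_normrX // => ab.
have b40 : 0 < b ^+ 4 by rewrite exprn_even_gt0 ?b0 ?orbT.
have b41 : b ^+ 4 <= 1 by rewrite -even_normrX // exprn_ile1.
have b80 : 0 <= b ^+ 8 by rewrite exprn_even_ge0.
(* On the imaginary axis the gain is b^4/12 - b^6/18 + b^8/144, hence at least b^4/36. The monomials
   containing a have coefficients of total absolute value below 8 < 300/36, whence the constant
   1/300. *)
have b64 : b ^+ 6 <= b ^+ 4.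
  rewrite -(even_normrX _ (n := 6)) // -(even_normrX _ (n := 4)) //.
  exact: ler_wiXn2l.
have a1 : `|a| <= 1 by lra.
have mono i j (i0 : (0 < i)%N) := norm_monomial_le j a1 b1 i0.
have lo i j : (0 < i)%N -> - `|a| <= a ^+ i * b ^+ j.
  by move=> i0; have := mono i j i0; rewrite ler_norml => /andP[].
have hi i j : (0 < i)%N -> a ^+ i * b ^+ j <= `|a|.
  by move=> i0; have := mono i j i0; rewrite ler_norml => /andP[].
have m1 := lo 1 0 isT; have m2 := lo 2 0 isT; have m3 := lo 3 0 isT.
(* Upper bounds serve the two monomials with negative coefficients, a^2 b^2 and a b^4. *)
have m4 := lo 4 0 isT; have m5 := hi 2 2 isT; have m6 := lo 5 0 isT.
have m7 := hi 1 4 isT; have m8 := lo 6 0 isT; have m9 := lo 4 2 isT.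
have m10 := lo 7 0 isT; have m11 := lo 5 2 isT; have m12 := lo 3 4 isT.
have m13 := lo 1 6 isT; have m14 := lo 8 0 isT; have m15 := lo 6 2 isT.
have m16 := lo 4 4 isT; have m17 := lo 2 6 isT.
rewrite /c4 /d4 /c3 /d3 /c2 /d2.
move: `|a| ab m1 m2 m3 m4 m5 m6 m7 m8 m9 m10 m11 m12 m13 m14 m15 m16 m17 => al.
by clear -b40 b64 b80; lra.
Qed.

End Amplification.

Theorem theorem4p2 (R : realType) (l r : nat)
    (hl : l = r.+1 \/ l = r.+2) :
  ((2 <= l)%N ->
    forall mu_c : R, 0 < mu_c -> unstable_in_the_limit (FE R) l r mu_c)
  /\
  ((3 <= l)%N ->
    forall mu_c : R, 0 < mu_c ->
      (forall m : butcher R 2, is_RK2 m -> unstable_in_the_limit m l r mu_c)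
      /\ unstable_in_the_limit (LSRK3 R) l r mu_c).
Proof.
split=> hl2 mu mu0.
  have lr : (2 <= l + r)%N by rewrite (leq_trans hl2) ?leq_addr.
  apply: (@unstable_of_near_imaginary R _ _ l r 2 mu 4^-1) => //.
  - exact: ltnW.
  - exact: fd_symbol_re_O4.
  move=> n u v X a b Xab b0 b1 ab; exists (1 + a), (0 + b).
  split; last exact: FE_amplification.
  rewrite stability_poly_FE rmorphD /= rmorph1 horner_mx_X.
  by apply: acts_asD => //; exact: acts_as1.
(* Since l <= r + 2, the assumption l >= 3 forces r >= 1, so that the fourth moment vanishes as
   well. *)
have lr : (4 <= l + r)%N.
  by case: hl hl2 => ->; case: (r) => [|[|k]] // _; rewrite !addSn !addnS.
have lr1 : (1 <= l + r)%N by exact: leq_trans lr.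
split.
  move=> m mRK2.
  apply: (@unstable_of_near_imaginary R _ _ l r 4 mu 32^-1) => //.
  - exact: fd_symbol_re_O6.
  move=> n u v X a b Xab b0 b1 ab.
  rewrite stability_poly_RK2 // !rmorphD /= rmorph1 linearZ /= rmorphXn /=.
  rewrite horner_mx_X expr2; do 2!eexists; split.
    apply: acts_asD; last exact: acts_asZ (acts_asM Xab Xab).
    by apply: acts_asD Xab; exact: acts_as1.
  exact: RK2_amplification.
apply: (@unstable_of_near_imaginary R _ _ l r 4 mu 300^-1) => //.
- exact: fd_symbol_re_O6.
move=> n u v X a b Xab b0 b1 ab.
have X2 := acts_asM Xab Xab; have X3 := acts_asM Xab X2.
have X4 := acts_asM Xab X3.
rewrite stability_poly_LSRK3 !rmorphD /= rmorph1 !linearZ /= !rmorphXn /=.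
rewrite horner_mx_X.
rewrite [X ^+ 4]exprS [X ^+ 3]exprS expr2.
do 2!eexists; split.
  apply: acts_asD; last exact: acts_asZ X4.
  apply: acts_asD; last exact: acts_asZ X3.
  apply: acts_asD; last exact: acts_asZ X2.
  by apply: acts_asD Xab; exact: acts_as1.
exact: LSRK3_amplification b0 b1 ab.
Qed.
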